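(* Let $n\ge1$ and $m\ge0$, and let $0$ denote the all-zero vertex of the Yoke graph $Y_{n,m}$. Then: (1) If $n=1$, then $\operatorname{ecc}_{Y_{n,m}}(0)=\binom{\lceil m/2\rceil+1}{2}+\binom{\lfloor m/2\rfloor+1}{2}$. (2) If $0\le m\le n$, then $\operatorname{ecc}_{Y_{n,m}}(0)=\lfloor n(m+1)/2\rfloor$. (3) If $2\le n\le m$, let $d_0=\binom{\lfloor (m+n)/2\rfloor+1}{2}+\binom{\lceil (m-n)/2\rceil+1}{2}$. Then (a) if either $2\mid(m-n)$ or $n\le\lceil (m+1)/2\rceil$, then $\operatorname{ecc}_{Y_{n,m}}(0)=d_0$; (b) otherwise $\operatorname{ecc}_{Y_{n,m}}(0)=d_0+n-\lceil (m+1)/2\rceil$.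
   Context: For integers $n\ge1$, $m\ge0$, the Yoke graph $Y_{n,m}$ is the simple graph whose vertices are the tuples $v=(v_0,v_1,\dots,v_m,v_{m+1})$ with $v_0,v_{m+1}\in\mathbb{Z}_n$ (the ''buckets''), $v_1,\dots,v_m\in\{0,1\}$, and $\sum_{i=0}^{m+1}v_i\equiv 0\pmod n$ (buckets identified with their least non-negative representatives). Two vertices $u,v$ are adjacent iff there is $0\le i\le m$ such that $u_j=v_j$ for all $j\notin\{i,i+1\}$ and either ($u_i=v_i+1$ and $u_{i+1}=v_{i+1}-1$) or ($u_i=v_i-1$ and $u_{i+1}=v_{i+1}+1$), bucket entries computed modulo $n$. The eccentricity $\operatorname{ecc}_G(x)$ of a vertex $x$ is the maximum graph distance from $x$ to any vertex of $G$. *)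

(* Defs.v *)
From mathcomp Require Import all_boot all_order all_algebra.
Set Implicit Arguments. Unset Strict Implicit. Unset Printing Implicit Defensive.
Import GRing.Theory Num.Theory.

(* Raw data of a vertex of Y_{n,m}: (v_0, (v_1..v_m), v_{m+1}),
   buckets in Z_n represented by their least non-negative representatives. *)
Definition yoke_raw (n m : nat) := ('I_n * m.-tuple bool * 'I_n)%type.

Definition yoke_ok (n m : nat) (v : yoke_raw n m) : bool :=
  (v.1.1 + count id v.1.2 + v.2) %% n == 0.

Definition yoke_vertex (n m : nat) := {v : yoke_raw n m | yoke_ok v}.

Definition ycoord (n m : nat) (v : yoke_vertex n m) (j : nat) : int :=
  let: (b0, bits, b1) := val v in
  if j == 0 then Posz (b0 : nat)
  else if j == m.+1 then Posz (b1 : nat)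
  else Posz (nth false bits j.-1 : nat).

Definition yeq (n m : nat) (j : nat) (a b : int) : bool :=
  if (j == 0) || (j == m.+1) then (a == b %[mod Posz n])%Z else a == b.

Definition yoke_adj (n m : nat) : rel (yoke_vertex n m) := fun u v =>
  (u != v) &&
  [exists i : 'I_m.+1,
    [forall j : 'I_m.+2, ((j : nat) != i) && ((j : nat) != i.+1) ==>
                         (ycoord u j == ycoord v j)] &&
    ((yeq n m i (ycoord u i) (ycoord v i + 1)%R &&
      yeq n m i.+1 (ycoord u i.+1) (ycoord v i.+1 - 1)%R) ||
     (yeq n m i (ycoord u i) (ycoord v i - 1)%R &&
      yeq n m i.+1 (ycoord u i.+1) (ycoord v i.+1 + 1)%R))].

Definition within (T : finType) (e : rel T) (k : nat) (x y : T) : Prop :=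
  exists p : seq T, [/\ path e x p, last x p = y & size p <= k].

Definition dist_is (T : finType) (e : rel T) (x y : T) (k : nat) : Prop :=
  within e k x y /\ (forall j, j < k -> ~ within e j x y).

Definition ecc_is (T : finType) (e : rel T) (x : T) (d : nat) : Prop :=
  (forall y, exists2 k, dist_is e x y k & k <= d) /\ (exists y, dist_is e x y d).

(* Main.v *)
(* Write f_i for the net number of moves made across the pair (i, i+1). A tuple
   f_0 >= f_1 >= ... >= f_m with steps 0 or 1 determines a vertex, every vertex
   arises this way, and f is unique up to adding a multiple of n to all entries.
   Each edge of the graph changes one f_i by one, and a nonzero f can always be
   moved one step towards 0 inside the set of such tuples, so the distance from
   0 is the minimum over k of sum_i |f_i + k n|, and the eccentricity is the
   maximum over f of this minimum.

   Upper bound: let A + B = m with B <= A and T(k) = binomial(k + 1, 2). If n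
   divides f_j for some B <= j <= A, shifting f_j to 0 gives at most
   T(A) + T(B). Otherwise 0 < f_j < n on [B, A] after a shift, and the costs of
   f and f - n add up to at most n (m + 1) + 2 B (B - 1).
   Lower bound: use a strictly decreasing f, a strictly decreasing f with the
   value n/2 repeated once, or an f with all values next to n/2. *)
Require Import Defs.
From mathcomp Require Import all_boot all_order all_algebra.
From mathcomp Require Import zify.

Set Implicit Arguments.
Unset Strict Implicit.
Unset Printing Implicit Defensive.
Import Order.TTheory GRing.Theory Num.Theory.

(** * Walks of bounded length and distance *)

Section Within.
Variables (T : finType) (e : rel T).

(** Walks of length at most [k] are finitely many tuples, so a search decides; the least length can
    then be found constructively. *)
Lemma within_dec k x y : {within e k x y} + {~ within e k x y}.
Proof.
have [b|b] := boolP [exists j : 'I_k.+1, [exists t : j.-tuple T,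
    path e x t && (last x t == y)]].
  left; case/existsP: b => j /existsP[t /andP[pt /eqP lt]].
  by exists t; split=> //; rewrite size_tuple -ltnS.
right=> -[p [pp lp sp]]; case/negP: b; apply/existsP.
exists (Ordinal (sp : size p < k.+1)); apply/existsP; exists (in_tuple p).
by rewrite /= pp lp eqxx.
Qed.

Lemma within_dist k x y :
  within e k x y -> exists2 j, dist_is e x y j & j <= k.
Proof.
elim: k {-2}k (leqnn k) => [|N IH] k le_kN wk.
  by exists k => //; split=> // j; move: le_kN; rewrite leqn0 => /eqP->.
case: k le_kN wk => [|k] le_kN wk.
  by exists 0.
have [w|nw] := within_dec k x y.
  by have [j dj le_jk] := IH k le_kN w; exists j => //; apply: leqW.
exists k.+1 => //; split=> // j lt_jk [p [pp lp sp]]; apply: nw.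
by exists p; split=> //; apply: leq_trans sp _.
Qed.

End Within.

(** * Flows, their cost, and single moves *)

Local Open Scope ring_scope.

(* The tuple (f_0, ..., f_m) shifted by one and padded with zeros, so that
   coordinate j of the vertex reached is extend j - extend (j + 1) for all j. *)
Definition extend (m : nat) (f : nat -> int) (j : nat) : int :=
  if j is k.+1 then (if (k <= m)%N then f k else 0) else 0.

(** Read [f i] as the signed number of units carried from coordinate i to i + 1, starting at the
    all-zero vertex. *)
Definition flow (n m : nat) (f : nat -> int) (v : yoke_vertex n m) : Prop :=
  forall j, (j <= m.+1)%N ->
  yeq n m j (ycoord v j) (extend m f j - extend m f j.+1).

Definition cost (m : nat) (f : nat -> int) : nat :=
  (\sum_(i < m.+1) `|f i|)%N.

(** The drop [f i - f i.+1] is coordinate i + 1 of the vertex reached, which must be a bit. *)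
Definition descending (m : nat) (f : nat -> int) : Prop :=
  forall i, (i < m)%N -> f i.+1 <= f i <= f i.+1 + 1.

Definition bump (f : nat -> int) (i : nat) (s : int) (k : nat) : int :=
  if k == i then f k + s else f k.

Lemma extend_bump m f i s j : (i <= m)%N ->
  extend m (bump f i s) j = extend m f j + (if j == i.+1 then s else 0).
Proof.
case: j => [|k] im; first by rewrite addr0.
rewrite /extend /bump eqSS; have [->|_] := eqVneq k i; first by rewrite im.
by rewrite addr0.
Qed.

Lemma cost_bump m f i s : (i <= m)%N ->
  (cost m (bump f i s) + `|f i| = cost m f + `|(f i + s)%R|)%N.
Proof.
move=> im; rewrite /cost (bigD1 (inord i)) //= [in RHS](bigD1 (inord i)) //=.
rewrite /bump inordK ?ltnS // eqxx.
rewrite (eq_bigr (fun j : 'I_m.+1 => `|f j|%N)) => [|j ji]; first lia.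
case: ifP => // /eqP ij; case/eqP: ji; apply: val_inj.
by rewrite /= inordK ?ltnS.
Qed.

Lemma eq_cost m f g : (forall i, (i <= m)%N -> f i = g i) ->
  cost m f = cost m g.
Proof. by move=> fg; apply: eq_bigr => i _; rewrite fg // -ltnS. Qed.

Lemma descending_shift m f c :
  descending m f -> descending m (fun i => f i + c).
Proof. by move=> df i im; have := df i im; lia. Qed.

Lemma count_telescope (bs : seq bool) (f : nat -> int) :
  (forall i, (i < size bs)%N -> (nth false bs i)%:Z = f i - f i.+1) ->
  (count id bs)%:Z = f 0%N - f (size bs).
Proof.
elim: bs f => [|b bs IH] f fE; first by rewrite subrr.
have := IH (f \o succn) (fun i => fE i.+1); have := fE 0%N isT; rewrite /=; lia.
Qed.

(** * Correspondence between vertices and flows *)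

Section Graph.
Variables n m : nat.
Implicit Types (f g : nat -> int) (u v w : yoke_vertex n m).

(* 0 divides a - b exactly when a = b, so this covers buckets and bits alike. *)
Let modulus (j : nat) : int := if (j == 0%N) || (j == m.+1) then n%:Z else 0.

Lemma yeqE j a b : yeq n m j a b = (modulus j %| a - b)%Z.
Proof.
rewrite /yeq /modulus; case: ifP => _; first by rewrite eqz_mod_dvd.
by rewrite dvd0z subr_eq0.
Qed.

Lemma yeq_refl j a : yeq n m j a a.
Proof. by rewrite yeqE subrr dvdz0. Qed.

Lemma yeq_sym j a b : yeq n m j a b = yeq n m j b a.
Proof. by rewrite /yeq; case: ifP => _; rewrite eq_sym. Qed.

Lemma yeq_trans j b a c : yeq n m j a b -> yeq n m j b c -> yeq n m j a c.
Proof.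
by rewrite !yeqE => ab bc; rewrite -(subrKA b) rpredD.
Qed.

Lemma yeqD j a b c d :
  yeq n m j a b -> yeq n m j c d -> yeq n m j (a + c) (b + d).
Proof. by rewrite !yeqE => ab cd; rewrite opprD addrACA rpredD. Qed.

Lemma yeq_ycoord j u v :
  yeq n m j (ycoord u j) (ycoord v j) -> ycoord u j = ycoord v j.
Proof.
rewrite /yeq /ycoord.
case: (val u) => -[b0 bs] b1; case: (val v) => -[c0 cs] c1 /=.
have [_|j0] := eqVneq j 0%N.
  by move=> /eqP; rewrite !modz_small ?ltz_nat ?ltn_ord.
have [_|jm] := eqVneq j m.+1.
  by move=> /eqP; rewrite !modz_small ?ltz_nat ?ltn_ord.
by move=> /eqP.
Qed.

Lemma ycoord_inj u v :
  (forall j, (j <= m.+1)%N -> ycoord u j = ycoord v j) -> u = v.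
Proof.
move=> uv; apply: val_inj; move: uv; rewrite /ycoord.
case: (val u) => -[b0 bs] b1; case: (val v) => -[c0 cs] c1 /= uv.
congr (_, _, _).
- by apply: val_inj; have [] := uv 0%N isT.
- apply: eq_from_tnth => i; have := uv i.+1.
  rewrite /= eqSS ltnS (ltnW (ltn_ord i)) (ltn_eqF (ltn_ord i)) => /(_ isT).
  by rewrite !(tnth_nth false) => -[]; do 2 case: nth.
- by apply: val_inj; have := uv m.+1 (leqnn _); rewrite eqxx => -[].
Qed.

Lemma flow_inj f u v : flow f u -> flow f v -> u = v.
Proof.
move=> fu fv; apply: ycoord_inj => j jm; apply: yeq_ycoord.
by apply: yeq_trans (fu j jm) _; rewrite yeq_sym; apply: fv.
Qed.

Lemma flow_bumpE f i s u v : (i <= m)%N -> flow f u ->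
  (forall j, (j <= m.+1)%N -> yeq n m j (ycoord v j)
     (ycoord u j + (if j == i.+1 then s else 0) - (if j == i then s else 0))) ->
  flow (bump f i s) v.
Proof.
move=> im fu uv j jm; apply: yeq_trans (uv j jm) _.
rewrite !extend_bump // eqSS.
have := yeqD (fu j jm) (yeq_refl j
  ((if j == i.+1 then s else 0) - (if j == i then s else 0))).
by rewrite !yeqE; congr (is_true (_ %| _)%Z); do 2 case: ifP => _; lia.
Qed.

Lemma flow_adj f u v : flow f u -> yoke_adj u v ->
  exists2 g, flow g v & (cost m g <= (cost m f).+1)%N.
Proof.
move=> fu /andP[_ /existsP[i /andP[/forallP same move_i]]].
have im : (i <= m)%N by rewrite -ltnS.
(* [s] is 1 if going from [u] to [v] carries a unit from i to i + 1, and -1 if it carries one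
   back. *)
pose s : int := if yeq n m i (ycoord u i) (ycoord v i + 1) &&
  yeq n m i.+1 (ycoord u i.+1) (ycoord v i.+1 - 1) then 1 else -1.
have [s1 vi vi1] : [/\ (`|s| = 1)%N, yeq n m i (ycoord u i) (ycoord v i + s) &
   yeq n m i.+1 (ycoord u i.+1) (ycoord v i.+1 - s)].
  rewrite /s; case: ifP move_i => [/andP[-> ->]|_] //=.
  by move=> /andP[-> ]; rewrite opprK.
exists (bump f i s); last first.
  by have := cost_bump f s im; lia.
apply: flow_bumpE im fu _ => j jm.
have [->|ji] := eqVneq j i.
  rewrite (ltn_eqF (ltnSn i)) yeq_sym.
  have := yeqD vi (yeq_refl i (- s)); rewrite !yeqE.
  by congr (is_true (_ %| _)%Z); lia.
have [->|ji1] := eqVneq j i.+1.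
  rewrite yeq_sym.
  have := yeqD vi1 (yeq_refl i.+1 s); rewrite !yeqE.
  by congr (is_true (_ %| _)%Z); lia.
have := same (Ordinal (jm : j < m.+2)%N); rewrite /= ji ji1 /= => /eqP->.
by rewrite addr0 subr0 yeq_refl.
Qed.

Lemma path_flow f u p : flow f u -> path (@yoke_adj n m) u p ->
  exists2 g, flow g (last u p) & (cost m g <= cost m f + size p)%N.
Proof.
elim: p f u => [|v p IH] f u fu /=; first by exists f; rewrite ?addn0.
case/andP=> /(flow_adj fu)[g gv gf] /(IH g _ gv)[h hv hg].
by exists h => //; lia.
Qed.

Lemma residue_ord (a : int) : (1 <= n)%N ->
  exists b : 'I_n, (n%:Z %| b%:Z - a)%Z.
Proof.
move=> hn; have n0 : n%:Z != 0 by lia.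
have lt : (`|(a %% n%:Z)%Z| < n)%N.
  have := ltz_pmod a (_ : 0 < n%:Z); have := modz_ge0 a n0; lia.
exists (Ordinal lt) => /=; rewrite gez0_abs ?modz_ge0 //.
by rewrite -eqz_mod_dvd modz_mod.
Qed.

(** The buckets are the residues of [- f 0] and [f m], the bits are the drops of [f]; the coordinate
    sum telescopes to 0 modulo n. *)
Lemma flow_exists f : (1 <= n)%N -> descending m f -> exists v, flow f v.
Proof.
move=> hn df.
have [b0 b0E] := residue_ord (- f 0%N) hn.
have [b1 b1E] := residue_ord (f m) hn.
pose bs := [tuple f i != f i.+1 | i < m].
have bsE i : (i < m)%N -> (nth false bs i)%:Z = f i - f i.+1.
  move=> im; rewrite -[i]/(val (Ordinal im)) -tnth_nth tnth_mktuple /=.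
  by have := df i im; case: eqVneq; lia.
have cE : (count id bs)%:Z = f 0%N - f m.
  rewrite -[in f m](size_tuple bs); apply: count_telescope => i.
  by rewrite size_tuple => /bsE.
have ok : yoke_ok (b0, bs, b1).
  rewrite /yoke_ok -/(dvdn n _) /=.
  suff : (n%:Z %| (b0 + count id bs + b1)%N%:Z)%Z by [].
  rewrite !PoszD cE; have := rpredD b0E b1E; congr (is_true (_ %| _)%Z); lia.
exists (exist _ (b0, bs, b1) ok) => j jm; rewrite yeqE /modulus /ycoord /=.
case: j jm => [|j]; first by rewrite /= sub0r.
rewrite ltnS eqSS => jm; rewrite /= jm; have [->|j_m] := eqVneq j m.
  by rewrite ltnn subr0.
have lt_jm : (j < m)%N by rewrite ltn_neqAle j_m.
by rewrite lt_jm bsE // subrr dvdz0.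
Qed.

Lemma vertex_flow v : exists2 f, descending m f & flow f v.
Proof.
case: v => -[[b0 bs] b1] ok.
(* Minus the partial sum of coordinates 0 to i; the last bucket then agrees because the total is 0
   modulo n. *)
pose f i : int := - b0%:Z - (count id (take i bs))%:Z.
have fE i : (i < m)%N -> f i = f i.+1 + (nth false bs i)%:Z.
  move=> im; rewrite /f (take_nth false) ?size_tuple // -cats1 count_cat /=.
  lia.
exists f => [i im|j jm]; first by rewrite (fE i im); case: nth; lia.
rewrite yeqE /modulus /ycoord /=.
case: j jm => [|j].
  by rewrite /f take0 /= => _; rewrite subr0 sub0r opprK subrr dvdz0.
rewrite ltnS eqSS => jm; rewrite /= jm; have [->|j_m] := eqVneq j m.
  rewrite ltnn subr0 /f take_oversize ?size_tuple //.
  move: ok; rewrite /yoke_ok -/(dvdn n _) /= -[(n %| _)%N]/((n%:Z %| _%:Z)%Z).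
  by rewrite !PoszD; congr (is_true (_ %| _)%Z); lia.
have lt_jm : (j < m)%N by rewrite ltn_neqAle j_m.
by rewrite lt_jm fE //; apply/dvdzP; exists 0; lia.
Qed.

Lemma flow_shift f v (k : int) :
  flow f v -> flow (fun i => f i + k * n%:Z) v.
Proof.
move=> fv j jm; have := fv j jm; rewrite !yeqE /modulus.
have nk : (n%:Z %| k * n%:Z)%Z by rewrite dvdz_mull ?dvdzz.
case: j jm => [|j] jm /=.
  by move=> /rpredD /(_ nk); congr (is_true (_ %| _)%Z); lia.
rewrite ltnS eqSS in jm *; rewrite jm; have [->|j_m] := eqVneq j m.
  by rewrite ltnn => /rpredB /(_ nk); congr (is_true (_ %| _)%Z); lia.
have -> : (j < m)%N by rewrite ltn_neqAle j_m.
by congr (is_true (_ %| _)%Z); lia.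
Qed.

(** Coordinate 0 fixes [f 0] modulo n, and the bits fix all differences exactly. *)
Lemma flow_unique f g v : flow f v -> flow g v ->
  exists k : int, forall i, (i <= m)%N -> g i = f i + k * n%:Z.
Proof.
move=> fv gv; have : yeq n m 0 (0 - f 0%N) (0 - g 0%N).
  by apply: yeq_trans (gv 0%N isT); rewrite yeq_sym; apply: fv.
rewrite yeqE /modulus /= => /dvdzP[k fg].
exists k; elim=> [|i IH] im; first lia.
have := fv i.+1 (leqW im); have := gv i.+1 (leqW im).
rewrite !yeqE /modulus /= eqSS (ltn_eqF im) !dvd0z im (ltnW im).
by have := IH (ltnW im); lia.
Qed.

Lemma flow_bump_diff f i s v w j : (i <= m)%N -> (j <= m.+1)%N ->
  flow f v -> flow (bump f i s) w ->
  yeq n m j (ycoord w j)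
    (ycoord v j + ((if j == i.+1 then s else 0) - (if j == i then s else 0))).
Proof.
move=> im jm fv fw; apply: yeq_trans (fw j jm) _.
rewrite !extend_bump // eqSS yeq_sym.
have := yeqD (fv j jm) (yeq_refl j
  ((if j == i.+1 then s else 0) - (if j == i then s else 0))).
by rewrite !yeqE; congr (is_true (_ %| _)%Z); do 2 case: ifP => _; lia.
Qed.

End Graph.

(** * Lowering the cost of a descending flow *)

Lemma cost_eq0 m f : cost m f = 0%N -> forall i, (i <= m)%N -> f i = 0.
Proof.
move=> /eqP; rewrite /cost sum_nat_eq0 => /forallP c0 i im.
by have /eqP := c0 (Ordinal (im : i < m.+1)%N); rewrite /=; lia.
Qed.

Lemma descending_homo m f i j : descending m f -> (i <= j)%N -> (j <= m)%N ->
  f j <= f i <= f j + (j - i)%N%:Z.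
Proof.
move=> df ij; rewrite -(subnKC ij); elim: (j - i)%N => [|d IH] jm.
  by rewrite addn0 subnn; lia.
by have := df (i + d)%N; have := IH; rewrite addnS; lia.
Qed.

(** If [f 0] is positive, lower the last entry of the initial plateau; otherwise [f m] is negative,
    and the first entry of the final plateau is raised. Either change keeps all drops in {0, 1}. *)
Lemma descending_reduce m f : descending m f -> (0 < cost m f)%N ->
  exists i (s : int), [/\ (i <= m)%N, s = 1 \/ s = -1,
    descending m (bump f i s) & (cost m (bump f i s)).+1 = cost m f].
Proof.
move=> df f_neq0; have [f0|f0] := ltP 0 (f 0%N).
  pose P i := (i == m) || (f i.+1 != f i).
  have exP : exists i, P i by exists m; rewrite /P eqxx.
  case: (ex_minnP exP) => i Pi min_i.
  have im : (i <= m)%N by apply: min_i; rewrite /P eqxx.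
  have const j : (j <= i)%N -> f j = f 0%N.
    elim: j => // j IH ji; rewrite -IH ?(ltnW ji) //; apply/eqP.
    by apply: contraLR ji => fj; rewrite -leqNgt min_i // /P fj orbT.
  exists i, (-1); have fi := const i (leqnn i); split=> //; first by right.
    move=> j jm; have := df j jm; rewrite /bump.
    have := const j; have [E|_] := eqVneq j.+1 i.
      by have [|_] := eqVneq j i; rewrite ?E; lia.
    have [ji|_] := eqVneq j i; last by [].
    by move: Pi; rewrite ji in jm *; rewrite /P; lia.
  by have := cost_bump f (-1) im; rewrite fi; lia.
have fm : f m < 0.
  rewrite ltNge; apply: contraTN f_neq0 => fm; rewrite -eqn0Ngt.
  rewrite /cost big1 // => i _; have im : (i <= m)%N by rewrite -ltnS.
  have := descending_homo df (leq0n i) im.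
  by have := descending_homo df im (leqnn m); lia.
pose P i := f i == f m.
have exP : exists i, P i by exists m; rewrite /P eqxx.
case: (ex_minnP exP) => i /eqP fi min_i.
have im : (i <= m)%N by apply: min_i; rewrite /P eqxx.
exists i, 1; split=> //; first by left.
  move=> j jm; have := df j jm; rewrite /bump.
  have [E|] := eqVneq j.+1 i.
    have [|_] := eqVneq j i; first lia.
    have := min_i j; rewrite /P; rewrite -E in fi *; lia.
  have [ji _ _|_ _] := eqVneq j i; last by [].
  rewrite ji in jm *.
  have im' : (i < m)%N by lia.
  have := descending_homo df (leqnSn i) im'.
  by have := descending_homo df im' (leqnn m); lia.
by have := cost_bump f 1 im; rewrite fi; lia.
Qed.

(** * Eccentricity as a max-min of costs *)

Section Eccentricity.
Variables (n m : nat) (z : yoke_vertex n m).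
Hypotheses (hn : (1 <= n)%N) (hz : forall j, ycoord z j = 0).

Lemma flow_zero f : (forall i, (i <= m)%N -> f i = 0) -> flow f z.
Proof.
move=> f0 j jm; rewrite hz.
have ext0 k : extend m f k = 0.
  by case: k => //= k; case: ifP => // /f0.
by rewrite !ext0 subrr yeq_refl.
Qed.

(** The walk is built backwards from [v]: each reduction of the flow yields the preceding vertex. *)
Lemma flow_within f v : descending m f -> flow f v ->
  within (@yoke_adj n m) (cost m f) z v.
Proof.
elim: {f}(cost m f) {-2}f (erefl (cost m f)) v => [|k IH] f cf v df fv.
  exists [::]; split=> //; apply: (flow_inj (f := f)) fv.
  by apply: flow_zero; apply: cost_eq0.
have [|i [s [im s1 db cb]]] := descending_reduce df; first by rewrite cf.
have [w bw] := flow_exists hn db.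
have [|p [pp lp sp]] := IH (bump f i s) _ w db bw; first by lia.
(* Adjacency has no loops, yet a move can fix the vertex, as for n = 1 and m = 0; the shorter walk
   then suffices. *)
have [wv|nwv] := eqVneq w v.
  by exists p; split; rewrite -?wv -?cb //; apply: leqW.
exists (rcons p v).
rewrite rcons_path last_rcons size_rcons -cb pp lp; split=> //=.
rewrite /yoke_adj nwv /=; apply/existsP; exists (inord i).
rewrite inordK ?ltnS //.
have diff j (jm : (j <= m.+1)%N) := flow_bump_diff im jm fv bw.
apply/andP; split.
  apply/forallP => j; apply/implyP => /andP[ji ji1].
  have := diff j (ltn_ord j); rewrite (negPf ji) (negPf ji1) subrr addr0.
  by move/yeq_ycoord->.
have := diff i (leqW im); have := diff i.+1 im.
rewrite !eqxx (gtn_eqF (ltnSn i)) (ltn_eqF (ltnSn i)) subr0 sub0r.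
by case: s1 => -> /= -> ->; rewrite ?orbT.
Qed.

(** For the lower bound, a walk of length [j] turns the zero flow into one of cost at most [j],
    which must be a shift of [f] by a multiple of n. *)
Lemma ecc_cost D :
  (forall f, descending m f ->
     exists k : int, (cost m (fun i => (f i + k * n%:Z)%R) <= D)%N) ->
  (exists2 f, descending m f &
     forall k : int, (D <= cost m (fun i => (f i + k * n%:Z)%R))%N) ->
  ecc_is (@yoke_adj n m) z D.
Proof.
move=> upper [f df lower]; have near v : within (@yoke_adj n m) D z v.
  have [g dg gv] := vertex_flow v; have [k kD] := upper g dg.
  have [|p [pp lp sp]] := flow_within _ (flow_shift k gv).
    exact: descending_shift.
  by exists p; split=> //; apply: leq_trans sp kD.
split=> [v|]; first exact: within_dist.
have [v fv] := flow_exists hn df.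
exists v; split=> // j jD [p [pp lp sp]].
have [|g] := path_flow (f := fun=> 0) _ pp; first exact: flow_zero.
rewrite lp (_ : cost m (fun=> 0) = 0%N) ?add0n => [gv gp|]; last exact: big1.
have [k gE] := flow_unique fv gv.
have := lower k; rewrite -(eq_cost gE) leqNgt.
by rewrite (leq_ltn_trans gp) ?(leq_ltn_trans sp).
Qed.

End Eccentricity.

(** * Triangular numbers and arithmetic progressions *)

Lemma double_bin2S k : (2 * 'C(k.+1, 2) = k * k.+1)%N.
Proof. by elim: k => // k IH; rewrite binS bin1; lia. Qed.

Section AffineSum.
Variables (F : nat -> nat) (a s : int).

(** The left side is twice the sum of the progression; doubling avoids division. *)
Lemma sum_affine_le k : (forall i, (i < k)%N -> a + s * i%:Z <= (F i)%:Z) ->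
  k%:Z * (2 * a + s * (k%:Z - 1)) <= 2 * (\sum_(i < k) F i)%N%:Z.
Proof.
elim: k => [|k IH] aF; first by rewrite big_ord0 mul0r.
have {IH} := IH (fun i ik => aF i (leqW ik)); have := aF k (leqnn _).
by rewrite big_ord_recr /= PoszD; lia.
Qed.

Lemma sum_affine_ge k : (forall i, (i < k)%N -> (F i)%:Z <= a + s * i%:Z) ->
  2 * (\sum_(i < k) F i)%N%:Z <= k%:Z * (2 * a + s * (k%:Z - 1)).
Proof.
elim: k => [|k IH] aF; first by rewrite big_ord0 mul0r.
have {IH} := IH (fun i ik => aF i (leqW ik)); have := aF k (leqnn _).
by rewrite big_ord_recr /= PoszD; lia.
Qed.

End AffineSum.

(** * Bounds on the cost of a flow *)

Lemma sum_addn (F : nat -> nat) k l :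
  (\sum_(i < k + l) F i = \sum_(i < k) F i + \sum_(i < l) F (k + i))%N.
Proof. by rewrite big_split_ord. Qed.

(** Drop the absolute values with the signs that are right at c = B, respectively c = A. The
    resulting bound is linear in [c], attains the triangular sum at that endpoint and grows away
    from the gap. *)
Lemma cost_staircase A B (c : int) : (B <= A)%N -> c <= B \/ A%:Z <= c ->
  ('C(A.+1, 2) + 'C(B.+1, 2) <= cost (A + B) (fun i => (c - i%:Z)%R))%N.
Proof.
move=> BA; have := double_bin2S A; have := double_bin2S B.
rewrite /cost; set F := fun i : nat => `|(c - i%:Z)%R|%N.
rewrite (_ : (\sum_(i < _) _ = \sum_(i < (A + B).+1) F i)%N) // => tB tA.
case=> cAB.
  rewrite (addnC A) -addnS sum_addn.
  have := @sum_affine_le F c (-1) B (fun i _ => ltac:(rewrite /F; lia)).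
  have := @sum_affine_le (fun i => F (B + i)%N) (B%:Z - c) 1 A.+1
    (fun i _ => ltac:(rewrite /F; lia)).
  nia.
rewrite -addSn sum_addn.
have := @sum_affine_le F c (-1) A.+1 (fun i _ => ltac:(rewrite /F; lia)).
have := @sum_affine_le (fun i => F (A.+1 + i)%N) (A%:Z + 1 - c) 1 B
  (fun i _ => ltac:(rewrite /F; lia)).
nia.
Qed.

(** Here |f i| is at most |i - j|, so the cost is at most T(j) + T(A + B - j), which is convex in
    [j] and maximal on [B, A] at the endpoints. *)
Lemma cost_flow_zero A B f j : descending (A + B) f ->
  (B <= j <= A)%N -> f j = 0 ->
  (cost (A + B) f <= 'C(A.+1, 2) + 'C(B.+1, 2))%N.
Proof.
move=> df /andP[Bj jA] fj; have jm : (j <= A + B)%N by lia.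
have := double_bin2S A; have := double_bin2S B.
rewrite /cost -(subnKC jm) -addSn (sum_addn (fun i => `|f i|%N)) => tB tA.
have left_f i : (i < j.+1)%N -> `|f i|%N%:Z <= j%:Z + -1 * i%:Z.
  by move=> ij; have := descending_homo df (ij : i <= j)%N jm; lia.
have right_f i : (i < A + B - j)%N -> `|f (j.+1 + i)%N|%N%:Z <= 1 + 1 * i%:Z.
  move=> im; have ji : (j <= j.+1 + i)%N by lia.
  by have := descending_homo df ji; lia.
have := sum_affine_ge left_f.
have := sum_affine_ge (F := fun i => `|f (j.+1 + i)%N|%N) right_f.
nia.
Qed.

(** An index in [B, A] contributes exactly n, and one at distance d outside at most n + 2 (d - 1);
    there are B indices on each side. *)
Lemma cost_pair A B n f : descending (A + B) f -> (B <= A)%N ->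
  (forall j, (B <= j <= A)%N -> 0 < f j < n%:Z) ->
  (cost (A + B) f + cost (A + B) (fun i => (f i - n%:Z)%R)
     <= n * (A + B).+1 + 2 * (B * B.-1))%N.
Proof.
move=> df BA fn; rewrite /cost -big_split /=.
set F := fun i => (`|f i| + `|(f i - n%:Z)%R|)%N.
rewrite (_ : (\sum_(i < _) _ = \sum_(i < (A + B).+1) F i)%N) //.
have -> : ((A + B).+1 = B + ((A - B).+1 + B))%N by lia.
rewrite sum_addn (sum_addn (fun i => F (B + i)%N)).
have fB : 0 < f B < n%:Z by apply: fn; rewrite leqnn.
have fA : 0 < f A < n%:Z by apply: fn; rewrite leqnn andbT.
have left_F i : (i < B)%N -> (F i)%:Z <= n%:Z + 2 * (B%:Z - 1) + -2 * i%:Z.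
  move=> iB; rewrite /F.
  by have := descending_homo df (ltnW iB) (leq_addl A B); lia.
have mid_F i : (i < (A - B).+1)%N -> (F (B + i)%N)%:Z <= n%:Z + 0 * i%:Z.
  by move=> iAB; rewrite /F; have := fn (B + i)%N; lia.
have right_F i :
    (i < B)%N -> (F (B + ((A - B).+1 + i))%N)%:Z <= n%:Z + 2 * i%:Z.
  move=> iB; have Ai : (A <= B + ((A - B).+1 + i))%N by lia.
  by rewrite /F; have := descending_homo df Ai; lia.
have := sum_affine_ge left_F; have := sum_affine_ge mid_F.
have := sum_affine_ge (F := fun i => F (B + ((A - B).+1 + i))%N) right_F.
have BB : (B * B.-1)%N%:Z = B%:Z * (B%:Z - 1) by case: (B) => // b; lia.
set S1 := (\sum_(i < B) F i)%N; set S2 := (\sum_(i < _) _)%N.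
set S3 := (\sum_(i < _) _)%N; set D := (A - B)%N.
have AE : A = (B + D)%N by lia.
by clearbody D; subst A; lia.
Qed.

Lemma cost_upper A B n f : (1 <= n)%N -> descending (A + B) f -> (B <= A)%N ->
  exists k : int, let c := cost (A + B) (fun i => (f i + k * n%:Z)%R) in
  (c <= 'C(A.+1, 2) + 'C(B.+1, 2))%N \/
  (2 <= n)%N /\ (2 * c <= n * (A + B).+1 + 2 * (B * B.-1))%N.
Proof.
move=> n1 df BA.
have [/existsP[j /andP[BjA /dvdzP[q fj]]]|] :=
  boolP [exists j : 'I_A.+1, (B <= j <= A)%N && (n%:Z %| f j)%Z].
  exists (- q); left.
  apply: (@cost_flow_zero A B _ j (descending_shift _ df) BjA).
  by rewrite fj mulNr subrr.
rewrite negb_exists => /forallP nodvd.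
have nz j (k : int) : (B <= j <= A)%N -> f j + k * n%:Z != 0.
  move=> BjA; have jA : (j < A.+1)%N by lia.
  have := nodvd (Ordinal jA); rewrite /= BjA; apply: contra => /eqP fj.
  by apply/dvdzP; exists (- k); lia.
(* This shift puts the value at [B] strictly between 0 and n. Drops of at most one cannot pass 0
   without hitting it, so all of [B, A] stays in that range. *)
pose q := (f B %/ n%:Z)%Z; pose g i := f i + - q * n%:Z.
have dg : descending (A + B) g by apply: descending_shift.
have gn j : (B <= j <= A)%N -> 0 < g j < n%:Z.
  move=> /andP[Bj]; rewrite -(subnKC Bj); elim: (j - B)%N => [|d IH] jA.
    have n0 : n%:Z != 0 by lia.
    have := nz B (- q); rewrite addn0 leqnn BA => /(_ isT); rewrite -/(g B).
    have -> : g B = (f B %% n%:Z)%Z by rewrite /g /q mulNr /modz.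
    by have := ltz_pmod (f B) (_ : 0 < n%:Z); have := modz_ge0 (f B) n0; lia.
  have := dg (B + d)%N; have := nz (B + d).+1 (- q); rewrite -/(g _).
  by rewrite addnS in jA *; have := IH; lia.
have := cost_pair dg BA gn.
(* The cheaper of [g] and [g - n] costs at most half of the pair bound. *)
have [le|lt] := leqP (cost (A + B) g) (cost (A + B) (fun i => (g i - n%:Z)%R)).
  exists (- q); right; rewrite -/g; split; last by lia.
  by have := gn B; lia.
exists (- q - 1); right; split; first by have := gn B; lia.
rewrite (_ : cost _ _ = cost (A + B) (fun i => (g i - n%:Z)%R)); first by lia.
by apply: eq_bigr => i _; rewrite /g; lia.
Qed.

(** * Extremal flows for the lower bounds *)

(** For p < m the value A - p occurs at both p and p + 1; removing one copy leaves a plain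
    staircase. *)
Lemma sum_flat (g : int -> nat) (A : int) p m : (p <= m)%N ->
  (\sum_(i < m.+1) g (A - i%:Z + (p < i)%N%:Z)%R
     = \sum_(i < m) g (A - i%:Z)%R + g (A - p%:Z)%R)%N.
Proof.
elim: m => [|m IH] pm.
  by move: pm; rewrite leqn0 => /eqP->; rewrite big_ord_recr /= !big_ord0 addr0.
have [p_m|mp] := leqP p m.
  rewrite big_ord_recr IH // [in RHS]big_ord_recr /= ltnS p_m.
  have -> : A - m.+1%:Z + 1%N%:Z = A - m%:Z by lia.
  by rewrite -!addnA [X in (_ + X)%N]addnC.
have -> : p = m.+1 by apply/eqP; rewrite eqn_leq pm.
rewrite big_ord_recr /= ltnn addr0; congr addn; apply: eq_bigr => i _.
by rewrite ltnNge ltnW ?addr0.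
Qed.

(** Values lie next to n/2; for odd n the larger one is used on the first half of the indices, to
    balance the costs of [f] and [f - n]. *)
Lemma lower_balanced m n : (1 <= n)%N ->
  exists2 f, descending m f & forall k : int,
    (n * (m + 1) %/ 2 <= cost m (fun i => (f i + k * n%:Z)%R))%N.
Proof.
move=> n1; pose f i : int := (n %/ 2 + (odd n && (i < (m + 1) %/ 2)))%N.
have df : descending m f by move=> i im; rewrite /f; case: odd => /=; lia.
have f_n i : 0 <= f i <= n%:Z by rewrite /f; lia.
exists f => // k.
have c0 : cost m f = (n * (m + 1) %/ 2)%N.
  pose F i := (n %/ 2 + (odd n && (i < (m + 1) %/ 2)))%N.
  rewrite /cost (_ : (\sum_(i < _) _ = \sum_(i < m.+1) F i)%N) //.
  have -> : m.+1 = ((m + 1) %/ 2 + (m.+1 - (m + 1) %/ 2))%N by lia.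
  rewrite sum_addn (eq_bigr (fun=> n %/ 2 + odd n)%N) => [|i _]; last first.
    by rewrite /F ltn_ord andbT.
  rewrite [X in (_ + X)%N](eq_bigr (fun=> n %/ 2)%N) => [|i _]; last first.
    by rewrite /F ltnNge leq_addr andbF addn0.
  rewrite !sum_nat_const !card_ord; have := divn_eq n 2; rewrite modn2.
  set q := (n %/ 2)%N; set h := ((m + 1) %/ 2)%N => nE.
  have hE : (m + 1 = h + h + odd (m + 1))%N by rewrite /h; lia.
  by rewrite nE; case: (odd n); lia.
clearbody f.
have cn : (cost m f + cost m (fun i => (f i - n%:Z)%R) = n * m.+1)%N.
  rewrite /cost -big_split /= (eq_bigr (fun=> n)) => [|i _]; last first.
    by move: (f i) (f_n i) => x; lia.
  by rewrite sum_nat_const card_ord mulnC.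
(* As 0 <= f <= n, shifts with k >= 0 cost at least as much as [f], the others at least as much as
   [f - n]. *)
have [k0|k0] := leP 0 k.
  rewrite -c0; apply: leq_sum => i _; have := f_n i; nia.
apply: (@leq_trans (cost m (fun i => (f i - n%:Z)%R))); first lia.
by apply: leq_sum => i _; have := f_n i; nia.
Qed.

(** Shifting by k n moves the zero of the staircase to A + k n, which never lies strictly between B
    and A because A - B <= n. *)
Lemma lower_staircase A B n : (B <= A)%N -> (A <= B + n)%N ->
  exists2 f, descending (A + B) f & forall k : int,
    ('C(A.+1, 2) + 'C(B.+1, 2) <=
      cost (A + B) (fun i => (f i + k * n%:Z)%R))%N.
Proof.
move=> BA An; exists (fun i => A%:Z - i%:Z) => [i _|k]; first lia.
rewrite (_ : cost _ _ = cost (A + B) (fun i => (A%:Z + k * n%:Z) - i%:Z)).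
  by apply: cost_staircase => //; have [k0|k0] := leP 0 k; nia.
by apply: eq_bigr => i _; rewrite addrAC.
Qed.

Lemma lower_flat_staircase B n : (1 <= n)%N ->
  exists2 f, descending (B + n + B.+1) f & forall k : int,
    ('C((B + n).+1, 2) + 'C(B.+1, 2) + n %/ 2 <=
      cost (B + n + B.+1) (fun i => (f i + k * n%:Z)%R))%N.
Proof.
(* [p] is chosen so that the repeated value is [w], half of n rounded down; its extra copy costs at
   least [w] after every shift. *)
move=> n1; set A := (B + n)%N; pose w := (n %/ 2)%N; pose p := (A - w)%N.
exists (fun i => A%:Z - i%:Z + (p < i)%N%:Z) => [i _|k]; first lia.
rewrite (_ : cost _ _ = (cost (A + B) (fun i => (A%:Z + k * n%:Z - i%:Z)%R) +
  `|(A%:Z + k * n%:Z - p%:Z)%R|)%N); last first.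
  rewrite /cost addnS -(sum_flat (fun x => `|x|%N)); last by rewrite /p; lia.
  by apply: eq_bigr => i _; congr absz; lia.
apply: leq_add.
  by apply: cost_staircase; rewrite /A; have [k0|k0] := leP 0 k; nia.
by rewrite /p /A /w; have [k0|k0] := leP 0 k; nia.
Qed.

Local Close Scope ring_scope.

(** * Choice of the splitting m = A + B in each case *)

Theorem theorem4p1 (n m : nat) (hn : 1 <= n) (z : yoke_vertex n m)
  (hz : forall j, ycoord z j = 0%R) :
  [/\ n = 1 ->
        ecc_is (@yoke_adj n m) z ('C((m + 1) %/ 2 + 1, 2) + 'C(m %/ 2 + 1, 2)),
      m <= n ->
        ecc_is (@yoke_adj n m) z (n * (m + 1) %/ 2)
    & 2 <= n -> n <= m ->
        let d0 := 'C((m + n) %/ 2 + 1, 2) + 'C((m - n + 1) %/ 2 + 1, 2) in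
        ((2 %| (m - n)) || (n <= (m + 2) %/ 2) -> ecc_is (@yoke_adj n m) z d0) /\
        (~~ ((2 %| (m - n)) || (n <= (m + 2) %/ 2)) ->
           ecc_is (@yoke_adj n m) z (d0 + (n - (m + 2) %/ 2)))].
Proof.
(* Both alternatives of the upper bound must stay below [D]; the [+ 1] is allowed because the pair
   bound controls twice an integer cost. *)
have ecc A B D : A + B = m -> B <= A -> 'C(A.+1, 2) + 'C(B.+1, 2) <= D ->
    (2 <= n -> n * m.+1 + 2 * (B * B.-1) <= 2 * D + 1) ->
    (exists2 f, descending m f & forall k : int,
       D <= cost m (fun i => f i + k * n%:Z)%R) ->
    ecc_is (@yoke_adj n m) z D.
  move=> mE BA triD pairD low; apply: ecc_cost => // f; rewrite -mE => df.
  have [k /= cost_k] := cost_upper hn df BA.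
  exists k; case: cost_k => [|[n2]]; first by move=> /leq_trans; apply.
  by have := pairD n2; rewrite -mE; lia.
rewrite !addn1; split=> [n1|mn|n2 nm d0].
- apply: (ecc ((m.+1) %/ 2) (m %/ 2)) => //; [lia| lia | by rewrite n1|].
  have := @lower_staircase (m.+1 %/ 2) (m %/ 2) n.
  by rewrite (_ : m.+1 %/ 2 + m %/ 2 = m); [apply; lia | lia].
(* With B = 0 the pair bound is n (m + 1), and it dominates 2 T(m) since m <= n. *)
- apply: (ecc m 0) => //; first by rewrite addn0.
  + by have := double_bin2S m; rewrite (bin_small (n := 1)) //; nia.
  + by lia.
  + by have := lower_balanced m hn; rewrite addn1.
(* A - B is n when m - n is even and n - 1 when it is odd. *)
rewrite /d0; set A := (m + n) %/ 2; set B := (m - n).+1 %/ 2.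
have mE : A + B = m by rewrite /A /B; lia.
have BA : B <= A by rewrite /A /B; lia.
have BB : ((B * B.-1)%N%:Z = B%:Z * (B%:Z - 1))%R by case: (B) => // b; lia.
have tA := double_bin2S A; have tB := double_bin2S B.
have dvd2 : 2 %| (m - n) = ~~ odd (m - n) by rewrite dvdn2.
rewrite dvd2; have [parity|parity] := boolP (odd (m - n)); split=> //= small.
- have AE : A.+1 = B + n by rewrite /A /B; lia.
  (* Exactly the condition for the pair bound not to exceed [2 * d0 + 1] when A + 1 = B + n. *)
  have n2B : n <= 2 * B + 1 by rewrite /B; lia.
  apply: (ecc A B) => //; last first.
    by rewrite -mE; apply: lower_staircase => //; lia.
  have nm1 : ((n * m.+1)%N%:Z = (A%:Z + 1 - B%:Z) * (A%:Z + B%:Z + 1))%R.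
    by rewrite PoszM -mE; congr (_ * _)%R; lia.
  by move=> _; rewrite {}/d0; clearbody A B; lia.
- have AE : A.+1 = B + n by rewrite /A /B; lia.
  have excess : n - (m + 2) %/ 2 + B = n %/ 2 by rewrite /B; lia.
  apply: (ecc A B) => //; first exact: leq_addr.
    have nm1 : ((n * m.+1)%N%:Z = (A%:Z + 1 - B%:Z) * (A%:Z + B%:Z + 1))%R.
      by rewrite PoszM -mE; congr (_ * _)%R; lia.
    by move=> _; rewrite {}/d0; clearbody A B; lia.
  (* m - n is odd, so B > 0. Taking b = B - 1 gives b + n = A, and T(b) = T(B) - B turns the extra
     n/2 into the claimed excess. *)
  have [b Bb] : exists b, B = b.+1 by exists B.-1; rewrite /B; lia.
  have := lower_flat_staircase b hn.
  have -> : b + n = A by lia.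
  have -> : A + b.+1 = m by lia.
  rewrite (_ : _ + n %/ 2 = d0 + (n - (m + 2) %/ 2)) // /d0 -/A -/B.
  have := double_bin2S b; move: tB; rewrite Bb; clearbody A B; lia.
- have AE : A = B + n by rewrite /A /B; lia.
  apply: (ecc A B) => //; last first.
    by rewrite -mE; apply: lower_staircase => //; lia.
  have nm1 : ((n * m.+1)%N%:Z = (A%:Z - B%:Z) * (A%:Z + B%:Z + 1))%R.
    by rewrite PoszM -mE; congr (_ * _)%R; lia.
  by move=> _; rewrite {}/d0; clearbody A B; lia.
Qed.
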